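(* Let $B\subset\mathbb{R}^4$ be an open set, let $f=(f^1,f^2,f^3):B\to T^3$ be a smooth map, let $X=B\times T^3$ carry the flat metric and the standard $G_2$-structure $\varphi$, and let $S=\{(y,f(y))\mid y\in B\}\subset X$ be the graph of $f$. Let $\nabla^B=d+\sqrt{-1}\sum_{a=4}^7A^ady^a$ be a Hermitian connection of the trivial complex line bundle $B\times\mathbb{C}\to B$, with $A^a:B\to\mathbb{R}$ smooth, and let $F^B_\nabla$ be its curvature. Let $\nabla$ be the real Fourier--Mukai transform of $(S,\nabla^B)$, with curvature $F_\nabla\in\sqrt{-1}\,\Omega^2(X)$. Then the following are equivalent. (1) $S$ is a coassociative submanifold for an appropriate orientation, and the 2-form on $S$ obtained from $-\sqrt{-1}F^B_\nabla\in\Omega^2(B)$ via the diffeomorphism $B\to S$, $y\mapsto(y,f(y))$, is anti-self-dual with respect to the induced metric on $S$ and the orientation which makes $S$ coassociative. (2) $\frac16F_\nabla^3+F_\nabla\wedge*\varphi=0$. (3) $\frac16F_\nabla^3+F_\nabla\wedge*\varphi=0$ and $\varphi\wedge*(F_\nabla^2)=0$.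
   Context: $T^3=\mathbb{R}^3/(2\pi\mathbb{Z})^3$. Coordinates on $B$ are $(y^4,y^5,y^6,y^7)$ and on $T^3$ are $(x^1,x^2,x^3)$; $X=B\times T^3$ has the flat metric $\sum(dx^i)^2+\sum(dy^a)^2$ and orientation $dx^{123}\wedge dy^{4567}$; $*$ is the Hodge star; powers of forms are wedge powers and $dx^{ij}=dx^i\wedge dx^j$, etc. Set $\omega_1=dy^{45}+dy^{67}$, $\omega_2=dy^{46}+dy^{75}$, $\omega_3=-(dy^{47}+dy^{56})$. The standard $G_2$-structure and its Hodge dual are $\varphi=dx^{123}+\sum_{i=1}^3dx^i\wedge\omega_i$ and $*\varphi=dy^{4567}+dx^{12}\wedge\omega_3+dx^{23}\wedge\omega_1+dx^{31}\wedge\omega_2$. Coassociative: an oriented 4-dimensional submanifold calibrated by $*\varphi$, i.e. $*\varphi$ restricts to the induced volume form. Real Fourier--Mukai transform of $(S,\nabla^B)$: identifying $B\times(T^3)^*$ with $X$, the Hermitian connection $\nabla=d+\sqrt{-1}\sum_{a=4}^7A^ady^a+\sqrt{-1}\sum_{j=1}^3f^jdx^j$ of the trivial complex line bundle over $X$. Its curvature is $F_\nabla=F^B_\nabla+F^S_\nabla$ with $F^B_\nabla=\sqrt{-1}\sum_{a,b=4}^7\frac{\partial A^b}{\partial y^a}dy^a\wedge dy^b$ and $F^S_\nabla=\sqrt{-1}\sum_{j=1}^3\sum_{a=4}^7\frac{\partial f^j}{\partial y^a}dy^a\wedge dx^j$. (The components $f^j$ are defined modulo $2\pi$, so their derivatives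 are well-defined functions on $B$.) *)

(* Defs.v *)
From HB Require Import structures.
From mathcomp Require Import all_boot all_order all_algebra.
From mathcomp Require Import generic_quotient ring_quotient.
From mathcomp Require Import all_classical all_reals all_analysis.
From mathcomp Require Import complex.

Set Implicit Arguments.
Unset Strict Implicit.
Unset Printing Implicit Defensive.

Import Order.TTheory GRing.Theory Num.Theory numFieldNormedType.Exports.

Local Open Scope classical_set_scope.
Local Open Scope ring_scope.
Local Open Scope complex_scope.

(* The full exterior algebra of the dual of K^n: the value of a form at A is
   the coefficient of the wedge product of the dx^i, i in A, in increasing
   order.  (The product [*] that finite functions inherit from K is the
   coefficientwise one; it is never used here, see [wedge].) *)
Notation form K n := {ffun {set 'I_n} -> K^o}.

Section Forms.
Variables (K : comNzRingType) (n : nat).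
Implicit Types (v w : form K n) (A I J : {set 'I_n}).

Definition shuffle_sign I J : K :=
  (-1) ^+ #|[set p : 'I_n * 'I_n | [&& p.1 \in I, p.2 \in J & p.2 < p.1]%N]%SET|.

Definition elem_form A : form K n := [ffun I => (I == A)%:R].

Definition dcoord (i : 'I_n) : form K n := elem_form [set i]%SET.

Definition wedge v w : form K n :=
  [ffun A : {set 'I_n} => \sum_(I : {set 'I_n} | I \subset A)
     shuffle_sign I (A :\: I)%SET * (v I * w (A :\: I)%SET)].

Definition wedge_exp v (k : nat) : form K n := iter k (wedge v) (elem_form finset.set0).

(* For the standard inner product and orientation of K^n, the star of the
   basis form indexed by A is the sign of (A, ~: A) times that of ~: A. *)
Definition hodge v : form K n :=
  [ffun A : {set 'I_n} => shuffle_sign (~: A)%SET A * v (~: A)%SET].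

End Forms.

Arguments dcoord {K n} i.
Arguments elem_form {K n} A.

Notation "v \wedge w" := (wedge v w) (at level 40, left associativity).

(* Pullback along the linear map [u |-> u *m M] from K^m to K^n. *)
Definition pullback (K : comNzRingType) (m n : nat) (M : 'M[K]_(m, n))
    (w : form K n) : form K m :=
  \sum_(A : {set 'I_n}) w A *:
    \big[@wedge K m/elem_form finset.set0]_(i in A) \sum_j M j i *: dcoord j.

Section OrientedInnerProduct.
Variables (R : rcfType) (n : nat).

(* Volume form and Hodge star on R^n (acting on complex-valued forms) of the
   inner product with Gram matrix G and of the orientation which is the
   standard one if o = false and the opposite one if o = true.  In indices,
   the star of w at J = ~: I is sqrt (det G) w^I sign(I, J), the indices of w
   being raised by the inverse of G, i.e. w being pulled back along it. *)
Definition vol_form (G : 'M[R]_n) (o : bool) : form R[i] n :=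
  ((-1) ^+ o * Num.sqrt (\det G))%:C *: elem_form [set: 'I_n]%SET.

Definition hodge_metric (G : 'M[R]_n) (o : bool) (w : form R[i] n) :
    form R[i] n :=
  ((-1) ^+ o * Num.sqrt (\det G))%:C *:
    hodge (pullback (map_mx (real_complex R) (invmx G)) w).

Definition anti_self_dual (G : 'M[R]_n) (o : bool) (w : form R[i] n) : Prop :=
  hodge_metric G o w = - w.

End OrientedInnerProduct.

(* Forms on X = B x T^3: dx j stands for dx^(j+1) and dy a for dy^(a+4); the
   order x^1, x^2, x^3, y^4, ..., y^7 gives the orientation of X. *)
Section G2.
Variable K : comNzRingType.

Definition dx (j : 'I_3) : form K (3 + 4) := dcoord (lshift 4 j).
Definition dy (a : 'I_4) : form K (3 + 4) := dcoord (rshift 3 a).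

Definition omega1 := dy 0 \wedge dy 1 + dy 2 \wedge dy 3.
Definition omega2 := dy 0 \wedge dy 2 + dy 3 \wedge dy 1.
Definition omega3 := - (dy 0 \wedge dy 3 + dy 1 \wedge dy 2).

Definition phi : form K (3 + 4) :=
  dx 0 \wedge dx 1 \wedge dx 2 +
  (dx 0 \wedge omega1 + dx 1 \wedge omega2 + dx 2 \wedge omega3).

End G2.

Section Torus.
Variable R : realType.

Definition period_lattice : {pred 'rV[R]_3} :=
  fun v => [forall j, v 0 j / (2 * pi) \is a Num.int].

Fact period_lattice_zmod_closed : zmod_closed period_lattice.
Proof.
split=> [|u v /forallP uP /forallP vP]; apply/forallP => j.
  by rewrite mxE mul0r rpred0.
by rewrite !mxE mulrBl rpredB.
Qed.

HB.instance Definition _ :=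
  GRing.isZmodClosed.Build 'rV[R]_3 period_lattice period_lattice_zmod_closed.

Definition torus3 := Quotient.quot period_lattice.

Definition to_torus (v : 'rV[R]_3) : torus3 := (\pi_torus3 v)%qT.

End Torus.

Section Smooth.
Variable R : realType.

Fixpoint Ck (k n : nat) (W : normedModType R) (U : set 'rV[R]_n)
    (h : 'rV[R]_n -> W) : Prop :=
  if k is k'.+1 then
    (forall y, U y -> differentiable h y) /\
    (forall i : 'I_n, Ck k' U ('D_(delta_mx 0 i) h))
  else forall y, U y -> {for y, continuous h}.

Definition smooth (n : nat) (W : normedModType R) (U : set 'rV[R]_n)
    (h : 'rV[R]_n -> W) : Prop :=
  forall k, Ck k U h.

Definition local_lift (f : 'rV[R]_4 -> torus3 R) (y : 'rV[R]_4)
    (g : 'rV[R]_4 -> 'rV[R]_3) : Prop :=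
  exists U : set 'rV[R]_4,
    [/\ open U, U y, smooth U g & forall z, U z -> to_torus (g z) = f z].

Definition smooth_to_torus (B : set 'rV[R]_4) (f : 'rV[R]_4 -> torus3 R) :
    Prop :=
  forall y, B y -> exists g, local_lift f y g.

(* The matrix of the d f^j / d y^a (row a, column j), read off any local lift
   of f, see [torus_jacobianE]. *)
Definition torus_jacobian (f : 'rV[R]_4 -> torus3 R) (y : 'rV[R]_4) :
    'M[R]_(4, 3) :=
  jacobian (xget (fun=> 0) [set g | local_lift f y g]) y.

End Smooth.

Lemma near_jacobian_eq (R : realType) (g h : 'rV[R]_4 -> 'rV[R]_3) y :
  differentiable g y -> differentiable h y ->
  (\forall z \near y, to_torus (g z) = to_torus (h z)) ->
  jacobian g y = jacobian h y.
Proof.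
move=> dg dh gh.
have pi20 : 0 < 2 * pi :> R by rewrite mulr_gt0 ?pi_gt0.
pose u z := g z - h z.
have uL z : to_torus (g z) = to_torus (h z) -> u z \in @period_lattice R.
  by move=> /eqP; rewrite -Quotient.idealrBE.
have cu : {for y, continuous u}.
  by apply: continuousB; apply: differentiable_continuous.
have u_cst : \forall z \near y, g z = h z + u y.
  have uy := nbhs_singleton gh.
  move/(_ _ (nbhsx_ballx (u y) _ pi20)): cu => cu.
  near=> z.
  have : u z - u y \in @period_lattice R.
    by apply: rpredB; apply: uL => //; near: z.
  have : ball (u y) (2 * pi) (u z) by near: z.
  move=> Bz /forallP zP.
  suff : u z = u y by move=> <-; rewrite /u addrC subrK.
  apply/eqP; rewrite -subr_eq0; apply/eqP/rowP => j; rewrite mxE.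
  have /intrP[m mE] := zP j.
  case: Bz => _ /(_ 0 j); rewrite /ball /= distrC.
  have zE : (u z - u y) 0 j = m%:~R * (2 * pi).
    by rewrite -mE divfK // gt_eqF.
  have -> : u z 0 j - u y 0 j = m%:~R * (2 * pi) by rewrite -zE !mxE.
  rewrite normrM (gtr0_norm pi20) gtr_pMl // -intr_norm (ltr_int R _ 1).
  move=> m1; have m0 : m = 0 by case: m m1 {mE zE} => [[|k]|k].
  move: zE; rewrite m0 mul0r => zE.
  by move: zE; rewrite !mxE.
have E (v : 'rV_4) : v *m jacobian g y = v *m jacobian h y.
  have Dg := deriveEjacobian v dg; have Dh := deriveEjacobian v dh.
  apply: (etrans (esym Dg)); apply: (etrans _ Dh).
  apply: (etrans (near_eq_derive v u_cst)).
  rewrite (@deriveD _ _ _ h (cst (u y))); last 2 first.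
  - exact: diff_derivable.
  - exact: derivable_cst.
  by rewrite derive_cst addr0.
by apply/row_matrixP => i; rewrite [LHS]rowE [RHS]rowE.
Unshelve. all: by end_near.
Qed.

Lemma torus_jacobianE (R : realType) (f : 'rV[R]_4 -> torus3 R) y g :
  local_lift f y g -> torus_jacobian f y = jacobian g y.
Proof.
move=> gl; rewrite /torus_jacobian.
have := @xgetPex _ (fun=> 0) [set h | local_lift f y h] (ex_intro _ g gl).
move: (xget _ _) => h -[V [Vo Vy hs hf]].
move: gl => -[U [Uo Uy gs gf]].
apply: near_jacobian_eq.
- by case: (hs 1%N) => + _; apply.
- by case: (gs 1%N) => + _; apply.
near=> z; rewrite gf ?hf //; near: z; exact: open_nbhs_nbhs.
Unshelve. all: by end_near.
Qed.

Section Graph.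
Variables (R : realType) (f : 'rV[R]_4 -> torus3 R).

(* Row a is the a-th coordinate tangent vector at (y, f y) of the graph S of f,
   in the coordinates x^1, x^2, x^3, y^4, ..., y^7.  Forms on S are identified
   with forms on B via y |-> (y, f y). *)
Definition graph_tangent (y : 'rV[R]_4) : 'M[R]_(4, 3 + 4) :=
  row_mx (torus_jacobian f y) 1%:M.

Definition graph_metric (y : 'rV[R]_4) : 'M[R]_4 :=
  graph_tangent y *m (graph_tangent y)^T.

(* Orientations of S are given relative to the coordinates y^4, ..., y^7. *)
Definition orientation (B : set 'rV[R]_4) (o : 'rV[R]_4 -> bool) : Prop :=
  forall y, B y -> \forall z \near y, o z = o y.

Definition coassociative_graph (B : set 'rV[R]_4) (o : 'rV[R]_4 -> bool) :
    Prop :=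
  forall y, B y ->
    pullback (map_mx (real_complex R) (graph_tangent y)) (hodge (phi R[i])) =
    vol_form (graph_metric y) (o y).

End Graph.

Section Curvature.
Variable R : realType.

(* The curvature of d + i sum_a A^a dy^a, on B for e := dcoord and on X for
   e := dy; A y is the row vector of the A^a at y, and the entry (a, b) of its
   Jacobian matrix is d A^b / d y^a. *)
Definition base_curvature (A : 'rV[R]_4 -> 'rV[R]_4) (n : nat)
    (e : 'I_4 -> form R[i] n) (y : 'rV[R]_4) : form R[i] n :=
  'i%C *: \sum_a \sum_b (jacobian A y a b)%:C *: (e a \wedge e b).

Definition fibre_curvature (f : 'rV[R]_4 -> torus3 R) (y : 'rV[R]_4) :
    form R[i] (3 + 4) :=
  'i%C *: \sum_j \sum_a
    (torus_jacobian f y a j)%:C *: (dy R[i] a \wedge dx R[i] j).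

Definition FM_curvature (A : 'rV[R]_4 -> 'rV[R]_4)
    (f : 'rV[R]_4 -> torus3 R) (p : 'rV[R]_4 * torus3 R) :
    form R[i] (3 + 4) :=
  base_curvature A (dy R[i]) p.1 + fibre_curvature f p.1.

End Curvature.

(* Main.v *)
Require Import Defs.
From mathcomp Require Import all_boot all_order all_algebra ring.

(* Everything happens at one point y.  Let v_1, v_2, v_3 be the gradients of
   the f^j, G the induced metric on S, E the 2-form -i F^B and, for cyclic
   (k, i, j), beta_k = omega_k + v_i /\ v_j, the restriction to S of the
   interior product of phi with d/dx^k.  The restrictions to S of phi and *phi
   are a 3-form n and a multiple c of dy^4567.  Four identities give the
   theorem:
   - F^3/6 + F /\ *phi is, up to the factor i, the Hodge star of
     sum_k (E /\ beta_k) dx^k - *n, so (2) says n = 0 and E /\ beta_k = 0;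
   - det G = c^2 + |*n|^2 + sum_k <*n, v_k>^2, so c = +- sqrt (det G) exactly
     when n = 0;
   - when n = 0, c E + G *E G = sum_kl <n_k, n_l> (E /\ beta_k) beta_l, with
     * the flat star of B and n_k = d/dx^k - v_k the normal frame of S; the
     left side is a multiple of the self-dual part of E, and pairing with *E
     makes the right side a positive definite quadratic form in the
     E /\ beta_k, so E is anti-self-dual exactly when they vanish;
   - the components of phi /\ *F^2 are combinations of those of n and of the
     E /\ beta_k, so (2) implies (3).
   The sign of c is locally constant, which gives the orientation. *)

Set Implicit Arguments.
Unset Strict Implicit.
Unset Printing Implicit Defensive.

Import Order.TTheory GRing.Theory Num.Theory.

Local Open Scope ring_scope.

(* [all_algebra] has another [form], which hides that of [Defs]. *)
Local Notation form K n := {ffun {set 'I_n} -> K^o}.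

(** * Exterior forms as binary trees *)

Section SetCons.
Variable n : nat.
Implicit Types (A B : {set 'I_n}) (b : bool).

(** A subset of ['I_n.+1] is given by a membership bit for [ord0] and a subset of ['I_n]; the bit
    selects the branch at the root of a tree. *)
Definition set_cons b A : {set 'I_n.+1} :=
  [set i | if unlift ord0 i is Some j then j \in A else b].

Definition set_tail (A : {set 'I_n.+1}) : {set 'I_n} := lift ord0 @^-1: A.

Lemma in_set_cons0 b A : (ord0 \in set_cons b A) = b.
Proof. by rewrite inE unlift_none. Qed.

Lemma in_set_consS b A j : (lift ord0 j \in set_cons b A) = (j \in A).
Proof. by rewrite inE liftK. Qed.

Definition in_set_cons := (in_set_cons0, in_set_consS).

Lemma set_consK b A : set_tail (set_cons b A) = A.
Proof. by apply/setP => j; rewrite inE in_set_consS. Qed.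

Lemma set_cons_tail (A : {set 'I_n.+1}) : set_cons (ord0 \in A) (set_tail A) = A.
Proof.
by apply/setP => i; rewrite inE; case: unliftP => [j|] ->; rewrite ?inE.
Qed.

Lemma set_cons_subset b A b' B :
  (set_cons b A \subset set_cons b' B) = (b ==> b') && (A \subset B).
Proof.
apply/subsetP/andP => [sAB|[bb' /subsetP sAB] i].
  split; first by apply/implyP; have := sAB ord0; rewrite !in_set_cons0.
  by apply/subsetP => j; have := sAB (lift ord0 j); rewrite !in_set_consS.
case: (unliftP ord0 i) => [j|] ->; rewrite !in_set_cons; first exact: sAB.
by move: bb' => /implyP.
Qed.

Lemma set_consD b A b' B :
  set_cons b A :\: set_cons b' B = set_cons (b && ~~ b') (A :\: B).
Proof.
apply/setP => i.
by case: (unliftP ord0 i) => [j|] ->; rewrite in_setD !in_set_cons ?in_setD// andbC.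
Qed.

Lemma set_consC b A : ~: set_cons b A = set_cons (~~ b) (~: A).
Proof.
apply/setP => i.
by case: (unliftP ord0 i) => [j|] ->; rewrite in_setC !in_set_cons ?in_setC.
Qed.

Lemma card_set_cons b A : #|set_cons b A| = (b + #|A|)%N.
Proof.
rewrite -!sum1_card big_mkcond [in RHS]big_mkcond /= big_ord_recl in_set_cons0.
by case: b; congr addn; apply: eq_bigr => j _; rewrite in_set_consS.
Qed.

Lemma sum_set_cons (V : nmodType) (P : pred {set 'I_n.+1})
    (F : {set 'I_n.+1} -> V) :
  \sum_(A | P A) F A =
  \sum_(A | P (set_cons false A)) F (set_cons false A) +
  \sum_(A | P (set_cons true A)) F (set_cons true A).
Proof.
rewrite (reindex (fun u : bool * {set 'I_n} => set_cons u.1 u.2)) /=; last first.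
  exists (fun A : {set 'I_n.+1} => (ord0 \in A, set_tail A)) => [[b A] _|A _] /=.
    by rewrite in_set_cons0 set_consK.
  exact: set_cons_tail.
pose G b A := if P (set_cons b A) then F (set_cons b A) else 0.
rewrite big_mkcond -(pair_bigA_idem _ G) /=; last exact: addr0.
by rewrite big_bool /= addrC -!big_mkcond.
Qed.

End SetCons.

Lemma set_ord0 (A : {set 'I_0}) : A = set0.
Proof. by apply/setP => -[]. Qed.

Lemma shuffle_signE (K : comNzRingType) n (I J : {set 'I_n}) :
  shuffle_sign K I J =
  (-1) ^+ (\sum_i \sum_j [&& i \in I, j \in J & j < i])%N.
Proof.
rewrite /shuffle_sign; congr (_ ^+ _).
rewrite -sum1_card big_mkcond pair_bigA /=; apply: eq_bigr => -[i j] _ /=.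
by rewrite inE /=; case: ifP.
Qed.

Lemma shuffle_sign_ord0 (K : comNzRingType) (I J : {set 'I_0}) :
  shuffle_sign K I J = 1.
Proof. by rewrite shuffle_signE big_ord0 expr0. Qed.

(** The new inversions are the pairs (i, 0) with i in I, present when 0 lies in the second set.
    Nothing is below 0, so [b] adds none. *)
Lemma shuffle_sign_cons (K : comNzRingType) n b b' (I J : {set 'I_n}) :
  shuffle_sign K (set_cons b I) (set_cons b' J) =
  (-1) ^+ (if b' then #|I| else 0)%N * shuffle_sign K I J.
Proof.
rewrite !shuffle_signE -exprD; congr (_ ^+ _).
rewrite big_ord_recl [X in (X + _)%N]big1 ?add0n; last first.
  by move=> j _; rewrite ltn0 !andbF.
under [LHS]eq_bigr do rewrite big_ord_recl in_set_consS in_set_cons0 /=.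
rewrite big_split /=; congr addn.
  case: b'; last by rewrite big1 // => i _; rewrite andbF.
  rewrite -sum1_card [in RHS]big_mkcond; apply: eq_bigr => i _.
  by rewrite andbT /=; case: (i \in I).
apply: eq_bigr => i _; apply: eq_bigr => j _.
by rewrite !in_set_consS.
Qed.

(* A form on K^n as a binary tree of depth n, the node at depth i standing for
   the sum of its left subtree and of the wedge product of the i-th coordinate
   form with its right subtree.  On trees, unlike on finite functions of sets,
   the operations compute, and [XZ] prunes the vanishing subtrees. *)
Inductive xform (K : Type) := XZ | XL of K | XN of xform K & xform K.
Arguments XZ {K}.

Section Trees.
Variable K : comNzRingType.
Implicit Types (s t : xform K).

Definition mkN s t := if (s, t) is (XZ, XZ) then XZ else XN s t.

Fixpoint scaleT (c : K) t : xform K :=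
  match t with
  | XZ => XZ
  | XL k => XL (c * k)
  | XN l r => XN (scaleT c l) (scaleT c r)
  end.

(* Trees of the wrong depth denote 0, see [coefT]. *)
Fixpoint addT n s t : xform K :=
  match s, t, n with
  | XZ, _, _ => t
  | _, XZ, _ => s
  | XL j, XL k, 0 => XL (j + k)
  | XN l r, XN l' r', n'.+1 => XN (addT n' l l') (addT n' r r')
  | XL _, _, 0 => s
  | _, XL _, 0 => t
  | XN _ _, _, _.+1 => s
  | _, _, _ => t
  end.

(** The grade involution: the sign of moving a coordinate 1-form past a form. *)
Fixpoint signT t : xform K :=
  match t with
  | XN l r => XN (signT l) (scaleT (-1) (signT r))
  | _ => t
  end.

(** With e the first coordinate form, (l + e r)(l' + e r') = l l' + e (r l' + [signT l] r'), because
    e e = 0 and l e = e [signT l]. *)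
Fixpoint wedgeT n s t : xform K :=
  match n, s, t with
  | 0, XL j, XL k => XL (j * k)
  | n'.+1, XN l r, XN l' r' =>
    mkN (wedgeT n' l l') (addT n' (wedgeT n' r l') (wedgeT n' (signT l) r'))
  | _, _, _ => XZ
  end.

(** Complementation swaps the branches; a first index that joins the complement has to pass all
    indices of the original set, whence [signT l]. *)
Fixpoint hodgeT n t : xform K :=
  match n, t with
  | n'.+1, XN l r => XN (hodgeT n' r) (hodgeT n' (signT l))
  | _, _ => t
  end.

Fixpoint oneT n : xform K := if n is n'.+1 then XN (oneT n') XZ else XL 1.

Fixpoint coordT n (i : nat) : xform K :=
  match n, i with
  | 0, _ => XZ
  | n'.+1, 0 => XN XZ (oneT n')
  | n'.+1, i'.+1 => XN (coordT n' i') XZ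
  end.

Fixpoint topT n : xform K := if n is n'.+1 then XN XZ (topT n') else XL 1.

(** Substitution of [al i] for the i-th coordinate form, by a Horner scheme. *)
Fixpoint pullT m n (al : nat -> xform K) t : xform K :=
  match n, t with
  | 0, XL k => scaleT k (oneT m)
  | n'.+1, XN l r =>
    addT m (pullT m n' (fun i => al i.+1) l)
           (wedgeT m (al 0%N) (pullT m n' (fun i => al i.+1) r))
  | _, _ => XZ
  end.

(** Vanishing as a nested conjunction of scalar equations, which [ring] settles one by one after
    evaluation. *)
Fixpoint zeroT n t : Prop :=
  match n, t with
  | 0, XL k => k = 0
  | n'.+1, XN l r => zeroT n' l /\ zeroT n' r
  | _, _ => True
  end.

Fixpoint coefT n t : {set 'I_n} -> K :=
  match n return {set 'I_n} -> K with
  | 0 => fun=> if t is XL k then k else 0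
  | n'.+1 => fun A =>
    if t is XN l r then coefT (if ord0 \in A then r else l) (set_tail A) else 0
  end.

Definition denote n t : form K n := [ffun A => coefT t A].

Lemma coefT_XZ n (A : {set 'I_n}) : coefT XZ A = 0.
Proof. by case: n A. Qed.

Lemma coefT_XN n l r b (A : {set 'I_n}) :
  coefT (XN l r) (set_cons b A) = if b then coefT r A else coefT l A.
Proof. by rewrite /= in_set_cons0 set_consK; case: b. Qed.

Lemma coefT_mkN n l r (A : {set 'I_n.+1}) : coefT (mkN l r) A = coefT (XN l r) A.
Proof. by case: l r => [|?|??] [|?|??] //=; case: ifP; rewrite coefT_XZ. Qed.

Lemma set_consP n (A : {set 'I_n.+1}) : exists b B, A = set_cons b B.
Proof. by exists (ord0 \in A), (set_tail A); rewrite set_cons_tail. Qed.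

Lemma coefT_scale n c t (A : {set 'I_n}) : coefT (scaleT c t) A = c * coefT t A.
Proof.
elim: n t A => [|n IHn] [|k|l r] A; rewrite /= ?mulr0 //.
by case: ifP; rewrite IHn.
Qed.

Lemma coefT_add n s t (A : {set 'I_n}) :
  coefT (addT n s t) A = coefT s A + coefT t A.
Proof.
elim: n s t A => [|n IHn] [|j|l r] [|k|l' r'] A; rewrite /= ?addr0 ?add0r //.
by case: ifP; rewrite IHn.
Qed.

Lemma coefT_sign n t (A : {set 'I_n}) : coefT (signT t) A = (-1) ^+ #|A| * coefT t A.
Proof.
elim: n t A => [|n IHn] [|k|l r] A; rewrite ?mulr0 //=.
  by rewrite (set_ord0 A) cards0 mul1r.
have [b [B ->]] := set_consP A.
rewrite in_set_cons0 set_consK card_set_cons; case: b; rewrite ?coefT_scale IHn //.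
by rewrite exprS -mulrA.
Qed.

(** Induction on n, splitting the sum by whether 0 lies in I. If 0 lies in A, the terms with 0
    outside I carry the sign (-1)^|I| of [signT l]; otherwise only l and l' contribute. *)
Lemma coefT_wedge n s t (A : {set 'I_n}) :
  coefT (wedgeT n s t) A =
  \sum_(I : {set 'I_n} | I \subset A)
    shuffle_sign K I (A :\: I) * (coefT s I * coefT t (A :\: I)).
Proof.
elim: n s t A => [|n IHn] s t A.
  rewrite (big_pred1 set0) => [|I]; last first.
    by rewrite /= (set_ord0 A) (set_ord0 I) subxx eqxx.
  rewrite shuffle_sign_ord0 mul1r.
  by case: s t => [|j|??] [|k|??]; rewrite /= ?mul0r ?mulr0.
have [c [B ->]] := set_consP A; rewrite sum_set_cons.
case: s => [|j|l r].
- by rewrite coefT_XZ !big1 ?addr0 // => I _; rewrite coefT_XZ mul0r mulr0.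
- by rewrite coefT_XZ !big1 ?addr0 // => I _; rewrite /= mul0r mulr0.
case: t => [|k|l' r'].
- by rewrite coefT_XZ !big1 ?addr0 // => I _; rewrite coefT_XZ !mulr0.
- by rewrite coefT_XZ !big1 ?addr0 // => I _; rewrite [X in _ * X]mulr0 mulr0.
rewrite [wedgeT _ _ _]/= coefT_mkN coefT_XN.
under eq_bigl do rewrite set_cons_subset implyFb.
under eq_bigr do rewrite set_consD andbT shuffle_sign_cons !coefT_XN.
under [X in _ + X]eq_bigl do rewrite set_cons_subset implyTb.
under [X in _ + X]eq_bigr do rewrite set_consD andbF shuffle_sign_cons !coefT_XN.
case: c => /=.
  rewrite coefT_add !IHn addrC; congr (_ + _); apply: eq_bigr => I _.
    by rewrite coefT_sign -[_ * coefT l I * _]mulrA mulrCA mulrA.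
  by rewrite mul1r.
rewrite IHn big_pred0_eq addr0; apply: eq_bigr => I _.
by rewrite mul1r.
Qed.

Lemma coefT_hodge n t (A : {set 'I_n}) :
  coefT (hodgeT n t) A = shuffle_sign K (~: A) A * coefT t (~: A).
Proof.
elim: n t A => [|n IHn] [|k|l r] A; rewrite ?coefT_XZ ?mulr0 //=.
  by rewrite shuffle_sign_ord0 mul1r.
have [b [B ->]] := set_consP A.
rewrite set_consC !in_set_cons0 !set_consK shuffle_sign_cons.
case: b => /=; rewrite IHn ?mul1r // coefT_sign.
by rewrite mulrCA mulrA.
Qed.

Lemma coefT_one n (A : {set 'I_n}) : coefT (oneT n) A = (A == set0)%:R.
Proof.
elim: n A => [|n IHn] A /=; first by rewrite (set_ord0 A) eqxx.
have [b [B ->]] := set_consP A; rewrite in_set_cons0 set_consK.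
rewrite -subset0 (_ : set0 = set_cons false set0) ?set_cons_subset.
  by case: b; rewrite /= ?coefT_XZ // subset0.
by apply/setP => i; case: (unliftP ord0 i) => [j|] ->; rewrite !in_set_cons ?inE.
Qed.

Lemma denote0 n : @denote n XZ = 0.
Proof. by apply/ffunP => A; rewrite !ffunE coefT_XZ. Qed.

Lemma denoteD n s t : denote n s + denote n t = denote n (addT n s t).
Proof. by apply/ffunP => A; rewrite !ffunE coefT_add. Qed.

Lemma denoteZ n c t : c *: denote n t = denote n (scaleT c t).
Proof. by apply/ffunP => A; rewrite !ffunE coefT_scale. Qed.

Lemma denoteN n t : - denote n t = denote n (scaleT (-1) t).
Proof. by rewrite -denoteZ scaleN1r. Qed.

Lemma denoteM n s t : denote n s \wedge denote n t = denote n (wedgeT n s t).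
Proof.
apply/ffunP => A; rewrite !ffunE coefT_wedge.
by apply: eq_bigr => I _; rewrite !ffunE.
Qed.

Lemma denote_hodge n t : hodge (denote n t) = denote n (hodgeT n t).
Proof. by apply/ffunP => A; rewrite !ffunE coefT_hodge. Qed.

Lemma denote1 n : elem_form finset.set0 = denote n (oneT n).
Proof. by apply/ffunP => A; rewrite !ffunE coefT_one. Qed.

Lemma denote_top n : elem_form [set: 'I_n] = denote n (topT n).
Proof.
apply/ffunP => A; rewrite !ffunE.
elim: n A => [|n IHn] A /=; first by rewrite (set_ord0 A) (set_ord0 setT) eqxx.
have [b [B ->]] := set_consP A; rewrite in_set_cons0 set_consK -subTset.
rewrite (_ : setT = set_cons true setT) ?set_cons_subset.
  by case: b; rewrite /= ?coefT_XZ // -IHn subTset.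
by apply/setP => i; case: (unliftP ord0 i) => [j|] ->; rewrite !in_set_cons ?inE.
Qed.

Lemma denote_coord n (i : 'I_n) k : val i = k -> dcoord i = denote n (coordT n k).
Proof.
move=> <-; apply/ffunP => A; rewrite !ffunE.
elim: n i A => [[]//|n IHn] i A.
have [b [B ->]] := set_consP A.
have -> : [set i] = set_cons (i == ord0) [set j | lift ord0 j == i].
  apply/setP => k'.
  by case: (unliftP ord0 k') => [j|] ->; rewrite in_set_cons ?inE // eq_sym.
rewrite eqEsubset !set_cons_subset; case: (unliftP ord0 i) => [j|] -> /=.
  rewrite in_set_cons0 set_consK add0n.
  rewrite (_ : [set _ | _] = [set j]); last first.
    by apply/setP => k'; rewrite !inE (inj_eq lift_inj).
  by case: b => /=; rewrite ?coefT_XZ ?andbF // -eqEsubset IHn.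
rewrite in_set_cons0 set_consK (_ : [set _ | _] = set0); last first.
  by apply/setP => k'; rewrite !inE.
by case: b; rewrite /= ?coefT_XZ ?andbF // coefT_one -eqEsubset.
Qed.

Lemma denote_eq0 n t : denote n t = 0 <-> zeroT n t.
Proof.
suff : (forall A : {set 'I_n}, coefT t A = 0) <-> zeroT n t.
  move=> <-; split=> [/ffunP t0 A|t0]; first by have := t0 A; rewrite !ffunE.
  by apply/ffunP => A; rewrite !ffunE.
elim: n t => [|n IHn] [|k|l r]; split=> //=.
- by apply; apply: set0.
- move=> lr0; split; apply/IHn => A.
    by have := lr0 (set_cons false A); rewrite in_set_cons0 set_consK.
  by have := lr0 (set_cons true A); rewrite in_set_cons0 set_consK.
- by move=> [/IHn l0 /IHn r0] A; case: ifP.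
Qed.

Lemma denote_eq n s t :
  denote n s = denote n t <-> zeroT n (addT n s (scaleT (-1) t)).
Proof.
rewrite -denote_eq0 -denoteD -denoteZ scaleN1r.
by split=> [->|/eqP]; rewrite ?subrr // subr_eq0 => /eqP.
Qed.

Lemma wedge0r n (v : form K n) : v \wedge 0 = 0.
Proof.
by apply/ffunP => A; rewrite !ffunE big1 // => I _; rewrite ffunE !mulr0.
Qed.

Lemma wedgeDr n (v w w' : form K n) : v \wedge (w + w') = v \wedge w + v \wedge w'.
Proof.
apply/ffunP => A; rewrite !ffunE -big_split /=.
by apply: eq_bigr => I _; rewrite ffunE !mulrDr.
Qed.

Lemma wedgeZr n c (v w : form K n) : v \wedge (c *: w) = c *: (v \wedge w).
Proof.
apply/ffunP => A; rewrite !ffunE [RHS]mulr_sumr.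
by apply: eq_bigr => I _; rewrite ffunE [RHS]mulrCA; congr (_ * _); apply: mulrCA.
Qed.

Lemma wedgeZl n c (v w : form K n) : (c *: v) \wedge w = c *: (v \wedge w).
Proof.
apply/ffunP => A; rewrite !ffunE [RHS]mulr_sumr.
by apply: eq_bigr => I _; rewrite ffunE -mulrA mulrCA.
Qed.

Lemma hodgeZ n c (v : form K n) : hodge (c *: v) = c *: hodge v.
Proof. by apply/ffunP => A; rewrite !ffunE; apply: mulrCA. Qed.

Lemma wedge_sumr n (I : finType) (P : pred I) (v : form K n) (F : I -> form K n) :
  v \wedge (\sum_(i | P i) F i) = \sum_(i | P i) v \wedge F i.
Proof. exact: (big_morph _ (wedgeDr v) (wedge0r v)). Qed.

Lemma denote_pull m n (al : nat -> xform K) (a : 'I_n -> form K m) t :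
  (forall i, a i = denote m (al i)) ->
  \sum_(A : {set 'I_n}) denote n t A *:
    \big[@wedge K m/elem_form finset.set0]_(i in A) a i =
  denote m (pullT m n al t).
Proof.
elim: n al a t => [|n IHn] al a t aE.
  rewrite (big_pred1 set0) => [|A]; last by rewrite /= (set_ord0 A) eqxx.
  rewrite big_pred0 => [|[]//]; rewrite ffunE denote1.
  by case: t => [|k|l r] /=; rewrite ?scale0r ?denote0 ?denoteZ.
case: t => [|k|l r].
- by rewrite big1 ?denote0 // => A _; rewrite ffunE scale0r.
- by rewrite big1 ?denote0 // => A _; rewrite ffunE scale0r.
(* [wedge] has no monoid structure here, so the iterated product is unfolded along the explicit list
   of indices, [ord0] first. *)
have ie : index_enum 'I_n.+1 = ord0 :: map (lift ord0) (index_enum 'I_n).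
  by rewrite ![index_enum _]unlock -!enumT enum_ordSl.
rewrite sum_set_cons /= -denoteD -denoteM -(aE ord0).
have IH := IHn (fun i => al i.+1) (fun j => a (lift ord0 j)) _ _.
rewrite -!IH; [|by move=> j; rewrite aE ..].
rewrite wedge_sumr; congr (_ + _); apply: eq_bigr => A _.
  rewrite !ffunE coefT_XN ie big_cons in_set_cons0 big_map; congr (_ *: _).
  by apply: eq_bigl => j; rewrite in_set_consS.
rewrite wedgeZr !ffunE coefT_XN ie big_cons in_set_cons0 big_map.
congr (_ *: (_ \wedge _)).
by apply: eq_bigl => j; rewrite in_set_consS.
Qed.

End Trees.

(** * Linear algebra of bivectors in dimension 4 *)

Lemma sum_ord3 (V : nmodType) (F : 'I_3 -> V) : \sum_i F i = F 0 + F 1 + F 2.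
Proof.
rewrite !big_ord_recl big_ord0 addr0 addrA.
by do ?congr (_ + _); congr F; apply: val_inj.
Qed.

Lemma sum_ord4 (V : nmodType) (F : 'I_4 -> V) :
  \sum_i F i = F 0 + F 1 + F 2 + F 3.
Proof.
rewrite !big_ord_recl big_ord0 addr0 !addrA.
by do ?congr (_ + _); congr F; apply: val_inj.
Qed.

Lemma ord3_ind (P : 'I_3 -> Prop) : P 0 -> P 1 -> P 2 -> forall i, P i.
Proof.
move=> P0 P1 P2 [[|[|[|//]]] lti].
- by rewrite (_ : Ordinal lti = 0) //; apply: val_inj.
- by rewrite (_ : Ordinal lti = 1) //; apply: val_inj.
- by rewrite (_ : Ordinal lti = 2) //; apply: val_inj.
Qed.

Lemma ord4_ind (P : 'I_4 -> Prop) : P 0 -> P 1 -> P 2 -> P 3 -> forall i, P i.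
Proof.
move=> P0 P1 P2 P3 [[|[|[|[|//]]]] lti].
- by rewrite (_ : Ordinal lti = 0) //; apply: val_inj.
- by rewrite (_ : Ordinal lti = 1) //; apply: val_inj.
- by rewrite (_ : Ordinal lti = 2) //; apply: val_inj.
- by rewrite (_ : Ordinal lti = 3) //; apply: val_inj.
Qed.

Record vec4 (K : Type) := Vec4 { v0 : K; v1 : K; v2 : K; v3 : K }.

Record biv4 (K : Type) :=
  Biv4 { b01 : K; b02 : K; b03 : K; b12 : K; b13 : K; b23 : K }.

Section Bivectors.
Variable K : comNzRingType.
Implicit Types (x y z u v w : vec4 K) (E F : biv4 K).
Implicit Types (J : 'M[K]_(4, 3)) (M D : 'M[K]_4).

Definition dotv u v := v0 u * v0 v + v1 u * v1 v + v2 u * v2 v + v3 u * v3 v.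
Definition scalev c u := Vec4 (c * v0 u) (c * v1 u) (c * v2 u) (c * v3 u).
Definition addv u v :=
  Vec4 (v0 u + v0 v) (v1 u + v1 v) (v2 u + v2 v) (v3 u + v3 v).
Definition oppv := scalev (-1).

Definition scaleb c E :=
  Biv4 (c * b01 E) (c * b02 E) (c * b03 E) (c * b12 E) (c * b13 E) (c * b23 E).
Definition addb E F :=
  Biv4 (b01 E + b01 F) (b02 E + b02 F) (b03 E + b03 F)
       (b12 E + b12 F) (b13 E + b13 F) (b23 E + b23 F).
Definition starb E := Biv4 (b23 E) (- b13 E) (b12 E) (b03 E) (- b02 E) (b01 E).

(** The inner product of 2-forms; [pairb (starb E) F] is the coefficient of E /\ F. *)
Definition pairb E F :=
  b01 E * b01 F + b02 E * b02 F + b03 E * b03 F +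
  b12 E * b12 F + b13 E * b13 F + b23 E * b23 F.

Definition wedgev u v :=
  Biv4 (v0 u * v1 v - v1 u * v0 v) (v0 u * v2 v - v2 u * v0 v)
       (v0 u * v3 v - v3 u * v0 v) (v1 u * v2 v - v2 u * v1 v)
       (v1 u * v3 v - v3 u * v1 v) (v2 u * v3 v - v3 u * v2 v).

Definition applyb E u :=
  Vec4 (b01 E * v1 u + b02 E * v2 u + b03 E * v3 u)
       (- b01 E * v0 u + b12 E * v2 u + b13 E * v3 u)
       (- b02 E * v0 u - b12 E * v1 u + b23 E * v3 u)
       (- b03 E * v0 u - b13 E * v1 u - b23 E * v2 u).

(* M E M^T, for M with rows [r0], ..., [r3] and E an antisymmetric matrix. *)
Definition conjb r0 r1 r2 r3 E :=
  Biv4 (pairb E (wedgev r0 r1)) (pairb E (wedgev r0 r2)) (pairb E (wedgev r0 r3))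
       (pairb E (wedgev r1 r2)) (pairb E (wedgev r1 r3)) (pairb E (wedgev r2 r3)).

Definition omega1b : biv4 K := Biv4 1 0 0 0 0 1.
Definition omega2b : biv4 K := Biv4 0 1 0 0 (-1) 0.
Definition omega3b : biv4 K := Biv4 0 0 (-1) (-1) 0 0.

(* With x, y, z the gradients of f^1, f^2, f^3: the Hodge star of the
   restriction of phi to the graph.  The three [omegab] matrices act as the
   complex structures of the omega_k. *)
Definition defect x y z : vec4 K :=
  oppv (addv (applyb (starb (wedgev x y)) z)
       (addv (applyb omega1b x) (addv (applyb omega2b y) (applyb omega3b z)))).

(* The restriction of *phi to the graph is [dvol] times dy^4567. *)
Definition dvol x y z : K :=
  1 + (pairb omega1b (wedgev y z) + pairb omega2b (wedgev z x)
       + pairb omega3b (wedgev x y)).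

(* The restriction to the graph of the interior product of phi with d/dx^k. *)
Definition beta1 x y z := addb omega1b (wedgev y z).
Definition beta2 x y z := addb omega2b (wedgev z x).
Definition beta3 x y z := addb omega3b (wedgev x y).

(** Multiplication by the induced metric G = 1 + x x^T + y y^T + z z^T. *)
Definition gram_apply x y z u : vec4 K :=
  addv u (addv (scalev (dotv x u) x)
         (addv (scalev (dotv y u) y) (scalev (dotv z u) z))).

Definition conj_gram x y z :=
  conjb (gram_apply x y z (Vec4 1 0 0 0)) (gram_apply x y z (Vec4 0 1 0 0))
        (gram_apply x y z (Vec4 0 0 1 0)) (gram_apply x y z (Vec4 0 0 0 1)).

(* Linear in [defect]; found by fitting an SO(3)-invariant ansatz. *)
Definition defect_remainder x y z E : biv4 K :=
  let n := defect x y z in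
  let T (w : biv4 K) v :=
    addb (starb (wedgev n (addv (applyb E (applyb w v))
                                (oppv (applyb w (applyb E v))))))
    (addb (wedgev (applyb w n) (applyb E v))
          (scaleb (pairb E w) (starb (wedgev n v)))) in
  addb (addb (T omega1b x) (addb (T omega2b y) (T omega3b z)))
   (addb (scaleb (dotv n (applyb E x)) (wedgev y z))
   (addb (scaleb (dotv n (applyb E y)) (wedgev z x))
         (scaleb (dotv n (applyb E z)) (wedgev x y)))).

(* The coefficients of the E /\ beta_k. *)
Definition pairing_beta1 x y z E := pairb (starb E) (beta1 x y z).
Definition pairing_beta2 x y z E := pairb (starb E) (beta2 x y z).
Definition pairing_beta3 x y z E := pairb (starb E) (beta3 x y z).

(** The sum over k, l of <n_k, n_l> (E /\ beta_k) beta_l, where <n_k, n_l> = delta_kl + <v_k,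
    v_l>. *)
Definition sd_part x y z E :=
  let w1 := pairing_beta1 x y z E in
  let w2 := pairing_beta2 x y z E in
  let w3 := pairing_beta3 x y z E in
  let p1 := w1 + dotv x x * w1 + dotv x y * w2 + dotv x z * w3 in
  let p2 := w2 + dotv y x * w1 + dotv y y * w2 + dotv y z * w3 in
  let p3 := w3 + dotv z x * w1 + dotv z y * w2 + dotv z z * w3 in
  addb (scaleb p1 (beta1 x y z))
  (addb (scaleb p2 (beta2 x y z)) (scaleb p3 (beta3 x y z))).

Definition colv n (M : 'M[K]_(4, n)) k := Vec4 (M 0 k) (M 1 k) (M 2 k) (M 3 k).

Definition alternate D :=
  Biv4 (D 0 1 - D 1 0) (D 0 2 - D 2 0) (D 0 3 - D 3 0)
       (D 1 2 - D 2 1) (D 1 3 - D 3 1) (D 2 3 - D 3 2).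

Definition conjm M E :=
  conjb (colv M^T 0) (colv M^T 1) (colv M^T 2) (colv M^T 3) E.

Definition gram J := 1%:M + J *m J^T.

(* [vecT n k x] and [bivT n k E] are the 1-form and the 2-form with
   coefficients x and E in the coordinate forms of indices k, ..., k + 3. *)
Definition vecT n k x : xform K :=
  addT n (scaleT (v0 x) (coordT K n k)) (addT n (scaleT (v1 x) (coordT K n k.+1))
  (addT n (scaleT (v2 x) (coordT K n k.+2)) (scaleT (v3 x) (coordT K n k.+3)))).

Definition bivT n k E : xform K :=
  let c i j := wedgeT n (coordT K n i) (coordT K n j) in
  addT n (scaleT (b01 E) (c k k.+1)) (addT n (scaleT (b02 E) (c k k.+2))
  (addT n (scaleT (b03 E) (c k k.+3)) (addT n (scaleT (b12 E) (c k.+1 k.+2))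
  (addT n (scaleT (b13 E) (c k.+1 k.+3)) (scaleT (b23 E) (c k.+2 k.+3)))))).

(* The curvature form divided by i. *)
Definition gformT x y z E : xform K :=
  addT 7 (bivT 7 3 E)
   (addT 7 (wedgeT 7 (vecT 7 3 x) (coordT K 7 0))
   (addT 7 (wedgeT 7 (vecT 7 3 y) (coordT K 7 1))
           (wedgeT 7 (vecT 7 3 z) (coordT K 7 2)))).

Definition phiT : xform K :=
  addT 7 (wedgeT 7 (wedgeT 7 (coordT K 7 0) (coordT K 7 1)) (coordT K 7 2))
 (addT 7
   (addT 7
     (wedgeT 7 (coordT K 7 0)
       (addT 7 (wedgeT 7 (coordT K 7 3) (coordT K 7 4))
               (wedgeT 7 (coordT K 7 5) (coordT K 7 6))))
     (wedgeT 7 (coordT K 7 1)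
       (addT 7 (wedgeT 7 (coordT K 7 3) (coordT K 7 5))
               (wedgeT 7 (coordT K 7 6) (coordT K 7 4)))))
   (wedgeT 7 (coordT K 7 2)
     (scaleT (-1) (addT 7 (wedgeT 7 (coordT K 7 3) (coordT K 7 6))
                          (wedgeT 7 (coordT K 7 4) (coordT K 7 5)))))).

(* The Hodge star of the 1-form with dx-components [w1], [w2], [w3] and
   dy-components [n]. *)
Definition coformT (n : vec4 K) (w1 w2 w3 : K) : xform K :=
  hodgeT 7 (addT 7 (vecT 7 3 n) (addT 7 (scaleT w1 (coordT K 7 0))
    (addT 7 (scaleT w2 (coordT K 7 1)) (scaleT w3 (coordT K 7 2))))).

End Bivectors.

(** Reduces trees and bivectors to polynomials in their entries and leaves the ring operations
    folded for [ring]. *)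
Ltac evalT := cbv [addT scaleT wedgeT hodgeT signT coordT oneT topT mkN zeroT
  pullT nth vecT bivT gformT coformT phiT defect dvol sd_part defect_remainder
  pairing_beta1 pairing_beta2 pairing_beta3 beta1 beta2 beta3
  gram_apply conj_gram conjb addv oppv scalev dotv omega1b omega2b omega3b
  starb scaleb addb wedgev applyb pairb colv alternate
  v0 v1 v2 v3 b01 b02 b03 b12 b13 b23].

(** * Polynomial identities for 2-forms, determinants and the induced metric *)

Section Identities.
Variable K : comNzRingType.
Implicit Types (x y z u v w : vec4 K) (E F : biv4 K).
Implicit Types (J : 'M[K]_(4, 3)) (M D : 'M[K]_4).

(** The projection identity without the assumption n = 0: the correction makes it an equality of
    polynomials. *)
Lemma selfdual_projection x y z E :
  addb (scaleb (dvol x y z) E) (conj_gram x y z (starb E)) =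
  addb (sd_part x y z E) (defect_remainder x y z E).
Proof.
case: x y z E => [x0 x1 x2 x3] [y0 y1 y2 y3] [z0 z1 z2 z3]
  [e01 e02 e03 e12 e13 e23].
evalT.
congr Biv4; ring.
Qed.

Lemma det_ord2 (M : 'M[K]_2) : \det M = M 0 0 * M 1 1 - M 0 1 * M 1 0.
Proof.
rewrite (expand_det_row _ 0) !big_ord_recl big_ord0 /cofactor !det_mx11 !mxE.
(* Indexing by natural numbers identifies entries whose ordinals are written differently, such as
   iterated [lift]s and numerals. *)
pose m i j := M (inord i) (inord j).
have mE a b : M a b = m a b by rewrite /m !inord_val.
rewrite !mE /= /bump /=; ring.
Qed.

Lemma det_ord3 (M : 'M[K]_3) :
  \det M = M 0 0 * (M 1 1 * M 2 2 - M 1 2 * M 2 1)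
         - M 0 1 * (M 1 0 * M 2 2 - M 1 2 * M 2 0)
         + M 0 2 * (M 1 0 * M 2 1 - M 1 1 * M 2 0).
Proof.
rewrite (expand_det_row _ 0) !big_ord_recl big_ord0 /cofactor !det_ord2 !mxE.
pose m i j := M (inord i) (inord j).
have mE a b : M a b = m a b by rewrite /m !inord_val.
rewrite !mE /= /bump /=; ring.
Qed.

Lemma det_ord4 M :
  let m2 a b := M 2 a * M 3 b - M 2 b * M 3 a in
  let m3 a b c := M 1 a * m2 b c - M 1 b * m2 a c + M 1 c * m2 a b in
  \det M = M 0 0 * m3 1 2 3 - M 0 1 * m3 0 2 3 + M 0 2 * m3 0 1 3
         - M 0 3 * m3 0 1 2.
Proof.
rewrite /= (expand_det_row _ 0) !big_ord_recl big_ord0 /cofactor !det_ord3 !mxE.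
pose m i j := M (inord i) (inord j).
have mE a b : M a b = m a b by rewrite /m !inord_val.
rewrite !mE /= /bump /=; ring.
Qed.

Lemma conjmM M M' E : conjm (M *m M') E = conjm M (conjm M' E).
Proof.
case: E => [e01 e02 e03 e12 e13 e23].
rewrite /conjm /colv !mxE !sum_ord4.
evalT.
congr Biv4; ring.
Qed.

Lemma conjm1 E : conjm 1%:M E = E.
Proof.
case: E => [e01 e02 e03 e12 e13 e23].
rewrite /conjm /colv !mxE /=.
evalT.
congr Biv4; ring.
Qed.

(** Transforming both factors of E /\ F by M multiplies the product by det M, and M^T acts on
    2-forms as the adjoint of M for [pairb]. *)
Lemma conjm_star M E :
  conjm M^T (starb (conjm M E)) = scaleb (\det M) (starb E).
Proof.
case: E => [e01 e02 e03 e12 e13 e23].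
rewrite det_ord4 /conjm /colv trmxK !mxE.
evalT.
congr Biv4; ring.
Qed.

Lemma gramE J a b :
  gram J a b = (a == b)%:R + (J a 0 * J b 0 + J a 1 * J b 1 + J a 2 * J b 2).
Proof. by rewrite !mxE sum_ord3 !mxE. Qed.

Lemma conjm_gram J E :
  conjm (gram J) E = conj_gram (colv J 0) (colv J 1) (colv J 2) E.
Proof.
rewrite /conjm /conj_gram.
congr (conjb _ _ _ _ E); rewrite /colv ![_^T _ _]mxE !gramE;
  evalT; congr Vec4; rewrite /=; ring.
Qed.

(** Over the reals the added terms are sums of squares: this is the calibration inequality for the
    dual of phi, with its equality case. *)
Lemma det_gram J (x := colv J 0) (y := colv J 1) (z := colv J 2)
    (n := defect x y z) :
  \det (gram J) = dvol x y z ^+ 2 +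
    (dotv n n + dotv n x ^+ 2 + dotv n y ^+ 2 + dotv n z ^+ 2).
Proof.
rewrite det_ord4 !gramE /= /n /x /y /z /colv.
evalT.
ring.
Qed.

(** * Forms on B and X translated into trees *)

Definition denoteE :=
  (@denote_hodge K, @denoteM K, @denoteN K, @denoteZ K, @denoteD K).

Lemma dxE :
  ((dx K 0 = denote 7 (coordT K 7 0)) * (dx K 1 = denote 7 (coordT K 7 1)) *
   (dx K 2 = denote 7 (coordT K 7 2)))%type.
Proof. by do !split; apply: denote_coord. Qed.

Lemma dyE :
  ((dy K 0 = denote 7 (coordT K 7 3)) * (dy K 1 = denote 7 (coordT K 7 4)) *
   (dy K 2 = denote 7 (coordT K 7 5)) * (dy K 3 = denote 7 (coordT K 7 6)))%type.
Proof. by do !split; apply: denote_coord. Qed.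

Lemma dcoord4E :
  ((dcoord (0 : 'I_4) = denote 4 (coordT K 4 0)) *
   (dcoord (1 : 'I_4) = denote 4 (coordT K 4 1)) *
   (dcoord (2 : 'I_4) = denote 4 (coordT K 4 2)) *
   (dcoord (3 : 'I_4) = denote 4 (coordT K 4 3)))%type.
Proof. by do !split; apply: denote_coord. Qed.

Lemma form4E D :
  \sum_a \sum_b D a b *: (dcoord a \wedge dcoord b) =
  denote 4 (bivT 4 0 (alternate D)).
Proof.
rewrite sum_ord4 !sum_ord4 !dcoord4E !denoteE; apply/denote_eq; evalT.
by do !split; ring.
Qed.

Lemma gformE J D :
  \sum_a \sum_b D a b *: (dy K a \wedge dy K b) +
  \sum_j \sum_a J a j *: (dy K a \wedge dx K j) =
  denote 7 (gformT (colv J 0) (colv J 1) (colv J 2) (alternate D)).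
Proof.
rewrite sum_ord4 !sum_ord4 sum_ord3 !sum_ord4 !dyE !dxE !denoteE.
apply/denote_eq; evalT.
by do !split; ring.
Qed.

Lemma sum_dcoord n (M : 'M[K]_(4, n)) i :
  \sum_j M j i *: dcoord j = denote 4 (vecT 4 0 (colv M i)).
Proof.
rewrite sum_ord4 !dcoord4E !denoteE; apply/denote_eq; evalT.
by do !split; ring.
Qed.

Lemma colv_delta (a : 'I_4) :
  denote 4 (vecT 4 0 (colv (1%:M : 'M[K]_4) a)) = denote 4 (coordT K 4 a).
Proof.
move: a; apply: ord4_ind; apply/denote_eq; rewrite /colv !mxE; evalT.
all: by do !split; rewrite /=; ring.
Qed.

Lemma pullback_biv M E :
  pullback M (denote 4 (bivT 4 0 E)) = denote 4 (bivT 4 0 (conjm M E)).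
Proof.
rewrite /pullback (@denote_pull K 4 4
  (nth XZ [:: vecT 4 0 (colv M 0); vecT 4 0 (colv M 1);
              vecT 4 0 (colv M 2); vecT 4 0 (colv M 3)])); last first.
  by move=> i; rewrite sum_dcoord; move: i; apply: ord4_ind.
apply/denote_eq; rewrite /conjm /colv !mxE; evalT.
by do !split; ring.
Qed.

Lemma phiE : phi K = denote 7 (phiT K).
Proof. by rewrite /phi /omega1 /omega2 /omega3 !dxE !dyE !denoteE. Qed.

Lemma pullback_star_phi J :
  pullback (row_mx J 1%:M) (hodge (phi K)) =
  dvol (colv J 0) (colv J 1) (colv J 2) *: elem_form [set: 'I_4].
Proof.
rewrite phiE !denoteE denote_top denoteE.
rewrite /pullback (@denote_pull K 4 7
  (nth XZ [:: vecT 4 0 (colv J 0); vecT 4 0 (colv J 1); vecT 4 0 (colv J 2);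
    coordT K 4 0; coordT K 4 1; coordT K 4 2; coordT K 4 3])); last first.
  move=> i; rewrite sum_dcoord; case: (split_ordP (i : 'I_(3 + 4))) => j ->.
    have -> : colv (row_mx J 1%:M) (lshift 4 j) = colv J j.
      by rewrite /colv !row_mxEl.
    by move: j; apply: ord3_ind.
  have -> : colv (row_mx J 1%:M) (rshift 3 j) = colv 1%:M j.
    by rewrite /colv !row_mxEr.
  by rewrite colv_delta; move: j; apply: ord4_ind.
(* Writing 3 + 4 as 7 lets the tree operations compute, as [evalT] does not unfold the addition. *)
apply/denote_eq; rewrite -?[(3 + 4)%N]/7%N; evalT.
by do !split; ring.
Qed.

Lemma hodge_biv E : hodge (denote 4 (bivT 4 0 E)) = denote 4 (bivT 4 0 (starb E)).
Proof.
rewrite denote_hodge; apply/denote_eq; evalT.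
by do !split; ring.
Qed.

Lemma denote_biv_inj E F :
  denote 4 (bivT 4 0 E) = denote 4 (bivT 4 0 F) -> E = F.
Proof.
move/denote_eq; case: E F => [a0 a1 a2 a3 a4 a5] [c0 c1 c2 c3 c4 c5]; evalT.
have e (a c : K) : a * (1 * 1) + -1 * (c * (1 * 1)) = 0 -> a = c.
  by move/eqP; rewrite !mulr1 mulN1r subr_eq0 => /eqP.
by move=> [[[_ [_ /e ->]] [[_ /e ->] [/e -> _]]]
  [[[_ /e ->] [/e -> _]] [[/e -> _] _]]].
Qed.

Lemma coform_eq0 (n : vec4 K) (w1 w2 w3 : K) :
  denote 7 (coformT n w1 w2 w3) = 0 <->
  n = Vec4 0 0 0 0 /\ [/\ w1 = 0, w2 = 0 & w3 = 0].
Proof.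
rewrite denote_eq0; case: n => [n0 n1 n2 n3]; evalT.
split; last by move=> [[-> -> -> ->] [-> -> ->]]; rewrite !(mul0r, mulr0).
rewrite !(mulN1r, mulr1, opprK).
have e (a : K) : - a = 0 -> a = 0 by move/eqP; rewrite oppr_eq0 => /eqP.
(* The pattern walks down the tree to its seven leaves of degree 6. *)
by move=> [[_ [_ [_ [_ [_ [_ ->]]]]]] [[_ [_ [_ [_ [_ /e ->]]]]]
  [[_ [_ [_ [_ ->]]]] [[_ [_ [_ /e ->]]] [[_ [_ ->]] [[_ /e ->] [-> _]]]]]]].
Qed.

(** * The two curvature equations *)

Section Equations.
Variables (x y z : vec4 K) (E : biv4 K).

Let n := defect x y z.
Let w1 := pairing_beta1 x y z E.
Let w2 := pairing_beta2 x y z E.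
Let w3 := pairing_beta3 x y z E.

(** For F = i g, F^3/6 + F /\ *phi = i (g /\ *phi - g^3/6); s stands for 1/6. *)
Lemma deformed_DT_coform s : s * 6%:R = 1 ->
  denote 7 (gformT x y z E) \wedge hodge (phi K) -
    s *: wedge_exp (denote 7 (gformT x y z E)) 3 =
  denote 7 (coformT (oppv n) w1 w2 w3).
Proof.
move=> s6; set g := denote _ _; have s6Z (v : form K 7) : v = s *: (6%:R *: v).
  by rewrite scalerA s6 scale1r.
(* Clearing the factor 1/6 leaves an identity with integer coefficients. *)
rewrite [_ \wedge _]s6Z [RHS]s6Z -scalerBr; congr (_ *: _).
rewrite /g phiE /wedge_exp /iter denote1 !denoteE; apply/denote_eq.
rewrite /n /w1 /w2 /w3.
case: x y z E => [x0 x1 x2 x3] [y0 y1 y2 y3] [z0 z1 z2 z3]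
  [e01 e02 e03 e12 e13 e23].
rewrite -?[(3 + 4)%N]/7%N; evalT.
by do !split; ring.
Qed.

Lemma phi_wedge_star_sq :
  phi K \wedge hodge (wedge_exp (denote 7 (gformT x y z E)) 2) =
  2%:R *: denote 7 (coformT
    (addv (oppv (applyb E n))
    (addv (scalev w1 x) (addv (scalev w2 y) (scalev w3 z))))
    (dotv n x) (dotv n y) (dotv n z)).
Proof.
rewrite phiE /wedge_exp /iter denote1 !denoteE; apply/denote_eq.
rewrite /n /w1 /w2 /w3.
case: x y z E => [x0 x1 x2 x3] [y0 y1 y2 y3] [z0 z1 z2 z3]
  [e01 e02 e03 e12 e13 e23].
rewrite -?[(3 + 4)%N]/7%N; evalT.
by do !split; ring.
Qed.

End Equations.

Lemma scale_biv c E :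
  c *: denote 4 (bivT 4 0 E) = denote 4 (bivT 4 0 (scaleb c E)).
Proof.
case: E => [e01 e02 e03 e12 e13 e23].
by rewrite denoteZ; apply/denote_eq; evalT; do !split; ring.
Qed.

Lemma defect_remainder_eq0 x y z E : defect x y z = Vec4 0 0 0 0 ->
  defect_remainder x y z E = Biv4 0 0 0 0 0 0.
Proof.
rewrite /defect_remainder => ->.
case: x y z E => [x0 x1 x2 x3] [y0 y1 y2 y3] [z0 z1 z2 z3]
  [e01 e02 e03 e12 e13 e23].
by evalT; congr Biv4; ring.
Qed.

Lemma addb0 E : addb E (Biv4 0 0 0 0 0 0) = E.
Proof. by case: E => *; rewrite /addb /= !addr0. Qed.

(** Pairing *E with beta_l gives w_l, so the result is |sum_k w_k n_k|^2, split into its dx and dy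
    components. *)
Lemma pairb_sd_part x y z E :
  let w1 := pairing_beta1 x y z E in
  let w2 := pairing_beta2 x y z E in
  let w3 := pairing_beta3 x y z E in
  let u := addv (scalev w1 x) (addv (scalev w2 y) (scalev w3 z)) in
  pairb (starb E) (sd_part x y z E) = w1 ^+ 2 + w2 ^+ 2 + w3 ^+ 2 + dotv u u.
Proof.
case: x y z E => [x0 x1 x2 x3] [y0 y1 y2 y3] [z0 z1 z2 z3]
  [e01 e02 e03 e12 e13 e23].
evalT; ring.
Qed.

End Identities.

(** * The equations at a point of the graph *)

Section Real.
Variable R : rcfType.
Implicit Types (x y z n : vec4 R) (E F : biv4 R) (J : 'M[R]_(4, 3)).

Lemma dotv_ge0 n : 0 <= dotv n n.
Proof. by rewrite /dotv !addr_ge0 // -expr2 sqr_ge0. Qed.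

Lemma dotv_eq0 n : dotv n n = 0 -> n = Vec4 0 0 0 0.
Proof.
case: n => [n0 n1 n2 n3]; rewrite /dotv /= -!expr2 => /eqP.
rewrite !paddr_eq0 ?addr_ge0 ?sqr_ge0 // !sqrf_eq0.
by move=> /andP[/andP[/andP[/eqP-> /eqP->] /eqP->] /eqP->].
Qed.

(** If v G = 0 then |v|^2 + |v J|^2 = 0. *)
Lemma det_gram_neq0 J : \det (gram J) != 0.
Proof.
apply/det0P => -[v v0]; rewrite mulmxDr mulmx1 mulmxA => /(congr1 (mulmx^~ v^T)).
rewrite mulmxDl mul0mx -mulmxA -trmx_mul => /matrixP/(_ 0 0); rewrite !mxE.
have sq m (u : 'rV[R]_m) : \sum_j u 0 j * u^T j 0 = \sum_j u 0 j ^+ 2.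
  by apply: eq_bigr => j _; rewrite mxE expr2.
have sq_ge0 m (u : 'rV[R]_m) : 0 <= \sum_j u 0 j ^+ 2.
  by rewrite sumr_ge0 // => i _; rewrite sqr_ge0.
rewrite !sq => /eqP; rewrite paddr_eq0 // psumr_eq0 => [/andP[/allP s0 _]|i _].
  move/negP: v0; apply; apply/eqP/rowP => j; rewrite mxE; apply/eqP.
  by rewrite -sqrf_eq0; apply: s0; rewrite mem_index_enum.
by rewrite sqr_ge0.
Qed.

Section Point.
Variables (J : 'M[R]_(4, 3)) (E : biv4 R).
Let x := colv J 0.
Let y := colv J 1.
Let z := colv J 2.

(** The Harvey-Lawson condition that phi vanishes on the tangent space of S. *)
Definition no_defect := defect x y z = Vec4 0 0 0 0.
Definition no_pairing :=
  [/\ pairing_beta1 x y z E = 0, pairing_beta2 x y z E = 0 &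
      pairing_beta3 x y z E = 0].

Lemma det_gram_ge0 : 0 <= \det (gram J).
Proof. by rewrite det_gram !addr_ge0 ?sqr_ge0 ?dotv_ge0. Qed.

Lemma no_defectP : no_defect <-> dvol x y z ^+ 2 = \det (gram J).
Proof.
rewrite det_gram -/x -/y -/z /no_defect; split=> [->|/eqP].
  by rewrite /dotv /= !mul0r !addr0 expr0n /= !addr0.
rewrite -[X in X == _]addr0 (inj_eq (addrI _)) eq_sym.
move: (dotv_ge0 (defect x y z)) (@dotv_eq0 (defect x y z)).
move: (dotv _ (defect x y z)) => s s_ge0 s0.
rewrite !paddr_eq0 ?addr_ge0 ?sqr_ge0 //.
by move=> /andP[/andP[/andP[/eqP/s0]]].
Qed.

(** Put c = [dvol] and S = *(G^-1 E G^-1), so that c S is the metric star of E up to orientation.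
    Since G *E G = c^2 S, the projection identity reads c (E + c S) = [sd_part]. One direction pairs
    it with *E and uses positivity, the other cancels c. *)
Lemma anti_self_dual_no_pairing : no_defect ->
  scaleb (dvol x y z) (starb (conjm (invmx (gram J)) E)) = scaleb (-1) E <->
  no_pairing.
Proof.
move=> n0; set S := starb _; set d := dvol x y z.
have d2 : d ^+ 2 = \det (gram J) by apply/no_defectP.
have d0 : d != 0 by rewrite -sqrf_eq0 d2 det_gram_neq0.
have GT : (gram J)^T = gram J by rewrite /gram linearD /= trmx1 trmx_mul trmxK.
have GK : conjm (gram J) (conjm (invmx (gram J)) E) = E.
  apply: etrans (esym (conjmM _ _ _)) _.
  by rewrite mulmxV ?conjm1 // unitmxE unitfE det_gram_neq0.
have dS : conjm (gram J) (starb E) = scaleb (d ^+ 2) S.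
  have := conjm_star (gram J) (conjm (invmx (gram J)) E).
  by rewrite GT GK -d2.
have := selfdual_projection x y z E.
rewrite defect_remainder_eq0 // addb0 -conjm_gram dS -/d => sdE.
have dE : scaleb d (addb E (scaleb d S)) = sd_part x y z E.
  by rewrite -sdE /scaleb /addb /=; congr Biv4; ring.
split=> [dSE|[w1 w2 w3]].
  have : pairb (starb E) (sd_part x y z E) = 0.
    rewrite -sdE -[X in pairb _ X](_ : scaleb d (addb E (scaleb d S)) = _).
      rewrite dSE /pairb /scaleb /addb /=; ring.
    by rewrite /scaleb /addb /=; congr Biv4; ring.
  rewrite pairb_sd_part => /eqP.
  rewrite !paddr_eq0 ?addr_ge0 ?sqr_ge0 ?dotv_ge0 // !sqrf_eq0.
  by move=> /andP[/andP[/andP[/eqP? /eqP?] /eqP?] _].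
have sd0 : sd_part x y z E = Biv4 0 0 0 0 0 0.
  rewrite /sd_part w1 w2 w3.
  by rewrite /scaleb /addb /=; congr Biv4; ring.
move: dE; rewrite sd0.
case: (E) (S) => [e01 e02 e03 e12 e13 e23] [s01 s02 s03 s12 s13 s23].
rewrite /scaleb /addb /= => -[].
have h (e s : R) : d * (e + d * s) = 0 -> d * s = - 1 * e.
  by move/eqP; rewrite mulf_eq0 (negPf d0) /= addrC addr_eq0 mulN1r => /eqP.
by do 6![move=> /h ->].
Qed.

End Point.

End Real.

From mathcomp Require Import all_classical all_reals all_analysis.
From mathcomp Require Import complex.

Import numFieldNormedType.Exports.

Local Open Scope classical_set_scope.
Local Open Scope ring_scope.
Local Open Scope complex_scope.

(** * From real data to complex-valued forms *)

Section Complexify.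
Variable R : realType.
Let rho : {rmorphism R -> R[i]} := real_complex R.
Implicit Types (x y z n : vec4 R) (E F : biv4 R) (J : 'M[R]_(4, 3)) (D : 'M[R]_4).

(** Positivity is argued over the reals, while the forms of the statement have complex coefficients;
    [mapv] and [mapb] connect the two. *)
Definition mapv x := Vec4 (rho (v0 x)) (rho (v1 x)) (rho (v2 x)) (rho (v3 x)).
Definition mapb E := Biv4 (rho (b01 E)) (rho (b02 E)) (rho (b03 E))
  (rho (b12 E)) (rho (b13 E)) (rho (b23 E)).

Lemma rho0P (a : R) : rho a = 0 <-> a = 0.
Proof. by split=> [/eqP|->]; rewrite ?rmorph0 // fmorph_eq0 => /eqP. Qed.

Lemma defect_map x y z : defect (mapv x) (mapv y) (mapv z) = mapv (defect x y z).
Proof.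
case: x y z => [x0 x1 x2 x3] [y0 y1 y2 y3] [z0 z1 z2 z3].
rewrite /mapv; evalT; congr Vec4; ring.
Qed.

Lemma dvol_map x y z : dvol (mapv x) (mapv y) (mapv z) = rho (dvol x y z).
Proof.
case: x y z => [x0 x1 x2 x3] [y0 y1 y2 y3] [z0 z1 z2 z3].
rewrite /mapv; evalT; ring.
Qed.

Lemma coform_map_eq0 n (w1 w2 w3 : R) :
  denote 7 (coformT (oppv (mapv n)) (rho w1) (rho w2) (rho w3)) = 0 <->
  n = Vec4 0 0 0 0 /\ [/\ w1 = 0, w2 = 0 & w3 = 0].
Proof.
have rhoN0 a : -1 * rho a = 0 -> a = 0.
  by rewrite mulN1r => /eqP; rewrite oppr_eq0 => /eqP/rho0P.
rewrite coform_eq0; split=> [[H [/rho0P-> /rho0P-> /rho0P->]]|[-> [-> -> ->]]].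
  move: (congr1 (@v0 _) H) (congr1 (@v1 _) H).
  move: (congr1 (@v2 _) H) (congr1 (@v3 _) H).
  by case: n {H} => [n0 n1 n2 n3] /rhoN0/= -> /rhoN0/= -> /rhoN0/= -> /rhoN0/= ->.
by rewrite /oppv /scalev /mapv /= !rmorph0 mulr0.
Qed.

Lemma pairing_map x y z E (x' := mapv x) (y' := mapv y) (z' := mapv z)
    (E' := mapb E) :
  ((pairing_beta1 x' y' z' E' = rho (pairing_beta1 x y z E)) *
   (pairing_beta2 x' y' z' E' = rho (pairing_beta2 x y z E)) *
   (pairing_beta3 x' y' z' E' = rho (pairing_beta3 x y z E)))%type.
Proof.
rewrite {}/x' {}/y' {}/z' {}/E'.
case: x y z E => [x0 x1 x2 x3] [y0 y1 y2 y3] [z0 z1 z2 z3]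
  [e01 e02 e03 e12 e13 e23].
rewrite /mapv /mapb; evalT.
by do !split; ring.
Qed.

Lemma colv_map J k : colv (map_mx rho J) k = mapv (colv J k).
Proof. by rewrite /colv !mxE. Qed.

Lemma alternate_map D : alternate (map_mx rho D) = mapb (alternate D).
Proof. by rewrite /alternate !mxE /mapb /= !rmorphB. Qed.

Lemma starb_map E : starb (mapb E) = mapb (starb E).
Proof. by rewrite /starb /mapb /= !rmorphN. Qed.

Lemma scaleb_map c E : scaleb (rho c) (mapb E) = mapb (scaleb c E).
Proof. by rewrite /scaleb /mapb /= !rmorphM. Qed.

Lemma conjm_map (M : 'M[R]_4) E : conjm (map_mx rho M) (mapb E) = mapb (conjm M E).
Proof.
case: E => [e01 e02 e03 e12 e13 e23].
rewrite /conjm /colv !mxE /mapb; evalT; congr Biv4; ring.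
Qed.

Lemma mapb_inj E F : mapb E = mapb F -> E = F.
Proof.
case: E F => [e01 e02 e03 e12 e13 e23] [f01 f02 f03 f12 f13 f23].
by rewrite /mapb => -[-> -> -> -> -> ->].
Qed.

Section Point.
Variables (f : 'rV[R]_4 -> torus3 R) (A : 'rV[R]_4 -> 'rV[R]_4) (y : 'rV[R]_4).
Let J := torus_jacobian f y.
Let E := alternate (jacobian A y).

Lemma FM_curvatureE t :
  FM_curvature A f (y, t) =
  'i%C *: denote 7
    (gformT (mapv (colv J 0)) (mapv (colv J 1)) (mapv (colv J 2)) (mapb E)).
Proof.
rewrite /FM_curvature /base_curvature /fibre_curvature -scalerDr; congr (_ *: _).
rewrite -!colv_map -alternate_map -gformE /=.
congr (_ + _); apply: eq_bigr => a _; apply: eq_bigr => b _; by rewrite !mxE.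
Qed.

Lemma base_curvatureE :
  (- 'i%C) *: base_curvature A dcoord y = denote 4 (bivT 4 0 (mapb E)).
Proof.
rewrite /base_curvature scalerA mulNr -expr2 sqr_i opprK scale1r.
rewrite -alternate_map -form4E.
by apply: eq_bigr => a _; apply: eq_bigr => b _; rewrite !mxE.
Qed.

Lemma deformed_DT_P t : let F := FM_curvature A f (y, t) in
  6%:R^-1 *: wedge_exp F 3 + F \wedge hodge (phi R[i]) = 0 <->
  no_defect J /\ no_pairing J E.
Proof.
have i3 : 'i%C ^+ 3 = - 'i%C :> R[i] by rewrite exprS sqr_i mulrN1.
rewrite /= FM_curvatureE; set g := denote _ _.
have -> : 6%:R^-1 *: wedge_exp ('i%C *: g) 3 + ('i%C *: g) \wedge hodge (phi R[i]) =
    'i%C *: (g \wedge hodge (phi R[i]) - 6%:R^-1 *: wedge_exp g 3).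
  rewrite /wedge_exp /= !(wedgeZl, wedgeZr) !scalerA scalerBr scalerA addrC.
  rewrite -mulrA -expr2 -exprS i3 mulrN scaleNr.
  by rewrite [_ * 'i%C]mulrC.
have s6 : 6%:R^-1 * 6%:R = 1 :> R[i] by rewrite mulVf // pnatr_eq0.
rewrite /g (deformed_DT_coform _ _ _ _ s6) defect_map !pairing_map.
rewrite -coform_map_eq0.
split=> [/eqP|->]; last by rewrite scaler0.
by rewrite scaler_eq0 (negPf (neq0Ci _)) => /eqP.
Qed.

Lemma phi_wedge_star_curvature_sq t : no_defect J -> no_pairing J E ->
  phi R[i] \wedge hodge (wedge_exp (FM_curvature A f (y, t)) 2) = 0.
Proof.
rewrite FM_curvatureE => n0 [w1 w2 w3]; set g := denote _ _.
have -> : wedge_exp ('i%C *: g) 2 = (-1) *: wedge_exp g 2.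
  by rewrite /wedge_exp /iter !(wedgeZl, wedgeZr) scalerA -expr2 sqr_i.
rewrite hodgeZ wedgeZr /g phi_wedge_star_sq defect_map !pairing_map.
rewrite n0 w1 w2 w3 (_ : denote _ _ = 0) ?scaler0 //.
apply/coform_eq0; rewrite /dotv /oppv /applyb /addv /scalev /mapv /= !rmorph0.
by rewrite !(mul0r, mulr0, addr0, subr0).
Qed.

Lemma graph_metricE : graph_metric f y = gram J.
Proof.
rewrite /graph_metric /graph_tangent -/J tr_row_mx mul_row_col trmx1 mulmx1.
by rewrite addrC.
Qed.

Lemma coassociativeP (o : bool) :
  pullback (map_mx rho (graph_tangent f y)) (hodge (phi R[i])) =
    vol_form (graph_metric f y) o <->
  dvol (colv J 0) (colv J 1) (colv J 2) = (-1) ^+ o * Num.sqrt (\det (gram J)).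
Proof.
rewrite graph_metricE /graph_tangent map_row_mx map_mx1 pullback_star_phi.
rewrite !colv_map dvol_map /vol_form; split=> [|->] //.
move=> /ffunP/(_ finset.setT); rewrite !ffunE eqxx => /=.
by rewrite ![_ *: _]mulr1 => -[].
Qed.

(** The first hypothesis replaces the signed square root in the metric star by [dvol]. *)
Lemma anti_self_dualP (o : bool) :
  dvol (colv J 0) (colv J 1) (colv J 2) = (-1) ^+ o * Num.sqrt (\det (gram J)) ->
  no_defect J ->
  anti_self_dual (graph_metric f y) o ((- 'i%C) *: base_curvature A dcoord y) <->
  no_pairing J E.
Proof.
move=> dE n0; rewrite -anti_self_dual_no_pairing // base_curvatureE graph_metricE.
rewrite /anti_self_dual /hodge_metric -dE.
rewrite (pullback_biv (map_mx rho (invmx (gram J)))) conjm_map hodge_biv starb_map.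
rewrite [_ *: _]scale_biv scaleb_map -scaleN1r scale_biv.
rewrite (_ : scaleb (-1) (mapb E) = mapb (scaleb (-1) E)); last first.
  by rewrite -scaleb_map rmorphN1.
by split=> [/denote_biv_inj/mapb_inj|->].
Qed.

End Point.
End Complexify.

(** * Local constancy of the orientation *)

Lemma cvg_dvol (R : realType) (T : Type) (F : set_system T) {FF : Filter F}
    (J : T -> 'M[R]_(4, 3)) (L : 'M[R]_(4, 3)) :
  (forall a j, J z a j @[z --> F] --> L a j) ->
  dvol (colv (J z) 0) (colv (J z) 1) (colv (J z) 2) @[z --> F] -->
  dvol (colv L 0) (colv L 1) (colv L 2).
Proof.
move=> JL; evalT.
repeat lazymatch goal with
| |- _ --> (_ + _) => apply: cvgD
| |- _ --> (_ * _) => apply: cvgM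
| |- _ --> - _ => apply: cvgN
| |- _ => first [exact: JL | exact: cvg_cst]
end.
Qed.

Section Orientation.
Variables (R : realType) (B : set 'rV[R]_4) (f : 'rV[R]_4 -> torus3 R).
Hypothesis f_smooth : smooth_to_torus B f.

(** A single local lift computes the Jacobian at all points near y, and its first partial
    derivatives are continuous. *)
Lemma torus_jacobian_cvg y a j : B y ->
  torus_jacobian f z a j @[z --> y] --> torus_jacobian f y a j.
Proof.
move=> /f_smooth[g [U [Uo Uy gs gf]]].
have gl z : U z -> local_lift f z g by move=> Uz; exists U; split.
have dg z : U z -> differentiable g z by case: (gs 1%N) => + _; apply.
have E z : U z -> torus_jacobian f z a j = 'D_(delta_mx 0 a) g z 0 j.
  move=> Uz; rewrite (torus_jacobianE (gl z Uz)) (deriveEjacobian _ (dg z Uz)).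
  by rewrite -rowE [RHS]mxE.
(* Rewriting with [E y Uy] would compare Jacobians up to conversion. *)
apply: (@eq_ind_r R _ (fun t : R => torus_jacobian f z a j @[z --> y] --> t)
  _ _ (E y Uy)).
have coord_cvg (D : 'rV[R]_4 -> 'rV[R]_3) :
    {for y, continuous D} -> D z 0 j @[z --> y] --> D y 0 j.
  move=> Dc; exact: (continuous_comp Dc (@coord_continuous _ _ _ 0 j (D y))).
have Dc : {for y, continuous ('D_(delta_mx 0 a) g)}.
  by case: (gs 1%N) => _ /(_ a) /(_ y Uy).
apply: cvg_trans (coord_cvg _ Dc).
have nU : \forall z \near nbhs y, U z by exact: open_nbhs_nbhs.
apply: (@near_eq_cvg _ _ (nbhs y)).
by apply: filterS nU => z Uz; rewrite E.
Qed.

End Orientation.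

(** * The equivalences from the pointwise criteria *)

Theorem proposition6p2 (R : realType) (B : set 'rV[R]_4)
    (f : 'rV[R]_4 -> torus3 R) (A : 'rV[R]_4 -> 'rV[R]_4)
    (B_open : open B) (f_smooth : smooth_to_torus B f)
    (A_smooth : smooth B A) :
  let X := B `*` [set: torus3 R] in
  let FB := base_curvature A dcoord in
  let F := FM_curvature A f in
  let stmt1 :=
    exists o : 'rV[R]_4 -> bool,
      [/\ orientation B o, coassociative_graph f B o &
         forall y, B y ->
           anti_self_dual (graph_metric f y) (o y) ((- 'i%C) *: FB y)] in
  let eqn2 (p : 'rV[R]_4 * torus3 R) :=
    6%:R^-1 *: wedge_exp (F p) 3 + F p \wedge hodge (phi R[i]) = 0 in
  let stmt2 := forall p, X p -> eqn2 p in
  let stmt3 :=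
    (forall p, X p -> eqn2 p) /\
    (forall p, X p -> phi R[i] \wedge hodge (wedge_exp (F p) 2) = 0) in
  (stmt1 <-> stmt2) /\ (stmt2 <-> stmt3).
Proof.
move=> X FB F stmt1 eqn2 stmt2 stmt3.
pose J y := torus_jacobian f y; pose E y := alternate (jacobian A y).
have stmt2P : stmt2 <-> forall y, B y -> no_defect (J y) /\ no_pairing (J y) (E y).
  split=> [eq2 y By|eq2 [y t] [By _]]; last exact/deformed_DT_P/eq2.
  (* The curvature is constant along the torus, so any point of the fibre serves. *)
  by apply/(deformed_DT_P f A y (to_torus 0))/eq2.
split; last first.
  split=> [s2|[]//]; split=> // -[y t] [By _].
  by have [n0 w0] := (stmt2P.1 s2) y By; exact: phi_wedge_star_curvature_sq.
rewrite stmt2P; split=> [[or [_ coas asd]] y By|eq2].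
  have dE := (coassociativeP _ _ _).1 (coas y By).
  have n0 : no_defect (J y).
    (* Squaring removes the orientation sign. *)
    by apply/no_defectP; rewrite dE exprMn sqrr_sign mul1r sqr_sqrtr // det_gram_ge0.
  by split=> //; apply/(anti_self_dualP A dE n0)/asd.
pose c y : R := dvol (colv (J y) 0) (colv (J y) 1) (colv (J y) 2).
have c2 y : B y -> c y ^+ 2 = \det (gram (J y)).
  by move=> /eq2[n0 _]; apply/no_defectP.
have dvolE y : B y -> dvol (colv (J y) 0) (colv (J y) 1) (colv (J y) 2) =
    (-1) ^+ (c y < 0)%R * Num.sqrt (\det (gram (J y))).
  by move=> By; rewrite -c2 // sqrtr_sqr; apply: realEsign; exact: num_real.
have c_cvg y : B y -> c z @[z --> y] --> c y.
  move=> By; apply: (@cvg_dvol R _ (nbhs y) _ J) => a j.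
  exact: (torus_jacobian_cvg f_smooth).
have c_neq0 y : B y -> c y != 0.
  by move=> By; rewrite -sqrf_eq0 c2 // det_gram_neq0.
(* Unification would otherwise unfold [c] and compare polynomials. *)
clearbody c.
(* The orientation of S is opposite to that of dy^4567 exactly where c is negative. *)
exists (fun y => c y < 0); split=> y By.
(* A continuous function that is nonzero at y keeps its sign nearby. *)
- move: (c_cvg y By) (c_neq0 y By); rewrite neq_lt => cy /orP[cy0|cy0].
    have c_lt0 : \forall z \near nbhs y, c z < 0.
      exact: (@cvgr_lt R _ (nbhs y) _ c (c y) cy 0 cy0).
    by apply: filterS c_lt0 => z ->; rewrite cy0.
  have c_gt0 : \forall z \near nbhs y, 0 < c z.
    exact: (@cvgr_gt R _ (nbhs y) _ c (c y) cy 0 cy0).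
  by apply: filterS c_gt0 => z cz0; rewrite (lt_gtF cz0) (lt_gtF cy0).
- exact/coassociativeP/dvolE.
- have [n0 w0] := eq2 y By.
  by apply/(anti_self_dualP A (dvolE y By) n0).
Qed.
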